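(* Let $A\subseteq B$ be an extension of integral domains and let $X$ be an indeterminate over $B$. If $A+XB[X]$ is a condensed domain, then $B$ is a field and $A$ is a condensed domain.
   Context: $A+XB[X]=\{f\in B[X] : f(0)\in A\}$. For an integral domain $D$ and nonzero ideals $I,J$ of $D$, the product $IJ$ is condensed if $IJ=\{ij : i\in I,\ j\in J\}$; $D$ is a condensed domain if $IJ$ is condensed for every pair of nonzero ideals $I,J$ of $D$. *)

(* Defs.v *)
From HB Require Import structures.
From mathcomp Require Import all_boot all_order all_algebra.
From mathcomp Require Import boolp classical_sets.

Set Implicit Arguments.
Unset Strict Implicit.
Unset Printing Implicit Defensive.

Import GRing.Theory.

Local Open Scope ring_scope.
Local Open Scope classical_set_scope.

(* The library's [idealr] only covers proper ideals, whereas the ideals of the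
   definition of a condensed domain include the whole ring.  *)
Definition is_ideal (D : comNzRingType) (I : set D) : Prop :=
  [/\ I 0,
      forall x y, I x -> I y -> I (x + y)
    & forall a x, I x -> I (a * x)].

Definition ideal_mul (D : comNzRingType) (I J : set D) : set D :=
  [set x | exists (n : nat) (a b : 'I_n -> D),
     [/\ forall k, I (a k), forall k, J (b k) & x = \sum_(k < n) a k * b k]].

Definition condensed_mul (D : comNzRingType) (I J : set D) : Prop :=
  ideal_mul I J = [set i * j | i in I & j in J].

Definition condensed_domain (D : idomainType) : Prop :=
  forall I J : set D, is_ideal I -> is_ideal J ->
    I <> [set 0] -> J <> [set 0] -> condensed_mul I J.

(* The library equips a subtype with a unit ring structure only when the subring
   is closed under inverses.  A unit of a general subring S is a unit of R whose
   inverse lies in S.  *)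
Section SubringType.
Variables (R : idomainType) (S : subringClosed R).

Definition subring_type : Type := {x : R | x \in S}.

HB.instance Definition _ := SubChoice.on subring_type.
HB.instance Definition _ := [SubChoice_isSubComNzRing of subring_type by <:].

Definition subring_unit : {pred subring_type} :=
  fun u => (val u \is a GRing.unit) && ((val u)^-1 \in S).

Definition subring_inv (u : subring_type) : subring_type := insubd u (val u)^-1.

Fact subring_mulVx : {in subring_unit, left_inverse 1 subring_inv *%R}.
Proof.
move=> u /andP[uU uVS]; apply: val_inj.
by rewrite rmorphM rmorph1 /= insubdK // mulVr.
Qed.

Fact subring_unitPl (x y : subring_type) : y * x = 1 -> subring_unit x.
Proof.
move=> /(congr1 val); rewrite rmorphM rmorph1 /= => yx1.
have xU : val x \is a GRing.unit by apply/unitrPr; exists (val y); rewrite mulrC.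
apply/andP; split=> //.
suff -> : (val x)^-1 = val y by exact: valP.
by rewrite -[LHS]mul1r -yx1 mulrK.
Qed.

Fact subring_invr_out : {in [predC subring_unit], subring_inv =1 id}.
Proof.
move=> u /negP uU; apply: val_inj; rewrite val_insubd; case: ifP => // uVS.
have [xU|/invr_out //] := boolP (val u \is a GRing.unit).
by case: uU; apply/andP.
Qed.

HB.instance Definition _ := GRing.ComNzRing_hasMulInverse.Build subring_type
  subring_mulVx subring_unitPl subring_invr_out.
HB.instance Definition _ :=
  [SubComUnitRing_isSubIntegralDomain of subring_type by <:].

End SubringType.

Section ConstantTermIn.
Variables (B : idomainType) (A : subringClosed B).

Definition const_term_in : {pred {poly B}} := fun f => f.[0] \in A.

Fact const_term_in_subring : subring_closed const_term_in.
Proof.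
split; first by rewrite unfold_in hornerC rpred1.
- by move=> f g fA gA; rewrite unfold_in hornerD hornerN rpredB.
- by move=> f g fA gA; rewrite unfold_in hornerM rpredM.
Qed.

HB.instance Definition _ :=
  GRing.isSubringClosed.Build {poly B} const_term_in const_term_in_subring.

End ConstantTermIn.

(* The ring A + X B[X].  *)
Definition poly_pair (B : idomainType) (A : subringClosed B) : idomainType :=
  subring_type (const_term_in A).

(* Main.v *)
Require Import Defs.
From HB Require Import structures.
From mathcomp Require Import all_boot all_order all_algebra.
From mathcomp Require Import boolp classical_sets ring.

(** Evaluation at 0 maps A + XB[X] onto A, and being condensed passes to
    surjective images: pull the ideals back and push the factors forward.
    To see that a nonzero b in B is invertible, consider the ideals X(b, X)B[X]
    and X(b, X + 1)B[X] of A + XB[X].  Since b = b(X + 1) - bX, their product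
    contains bX^2, so b = p q with p in (b, X) and q in (b, X + 1).  By degree
    p and q are constants, hence multiples of b, and b^2 divides b. *)

Set Implicit Arguments.
Unset Strict Implicit.
Unset Printing Implicit Defensive.

Import GRing.Theory.

Local Open Scope ring_scope.
Local Open Scope classical_set_scope.

(** The reverse inclusion always holds, a single product being a sum of length one. *)
Lemma condensed_mulP (D : comNzRingType) (I J : set D) :
  ideal_mul I J `<=` [set i * j | i in I & j in J] -> condensed_mul I J.
Proof.
move=> sub; rewrite /condensed_mul eqEsubset; split=> // _ [i Ii [j Jj <-]].
by exists 1%N, (fun=> i), (fun=> j); split=> //; rewrite big_ord1.
Qed.

Lemma nonzero_ideal (D : comNzRingType) (I : set D) (x : D) :
  I x -> x != 0 -> I <> [set 0].
Proof. by move=> Ix /eqP x0 I0; apply: x0; move: Ix; rewrite I0. Qed.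

Lemma ideal_neq0 (D : comNzRingType) (I : set D) :
  is_ideal I -> I <> [set 0] -> exists2 x, I x & x != 0.
Proof.
move=> [I0 _ _] In0; apply: contrapT => noI; apply: In0.
rewrite eqEsubset; split=> [x Ix|_ -> //].
by apply/eqP; apply: contraPT noI => x0 []; exists x.
Qed.

Section SurjectiveImage.
Variables (D E : idomainType) (phi : {rmorphism D -> E}).
Hypothesis phi_surj : forall y, exists x, phi x = y.

Lemma is_ideal_preimage (I : set E) : is_ideal I -> is_ideal (phi @^-1` I).
Proof.
move=> [I0 ID IM]; split=> [|x y Ix Iy|a x Ix] /=.
- by rewrite rmorph0.
- by rewrite rmorphD; apply: ID.
- by rewrite rmorphM; apply: IM.
Qed.

Lemma preimage_ideal_neq0 (I : set E) :
  is_ideal I -> I <> [set 0] -> phi @^-1` I <> [set 0].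
Proof.
move=> idI /(ideal_neq0 idI)[y Iy y0]; have [x xy] := phi_surj y.
apply: (@nonzero_ideal _ _ x); first by rewrite /= xy.
by apply: contraNneq y0 => x0; rewrite -xy x0 rmorph0.
Qed.

Lemma condensed_domain_surj : condensed_domain D -> condensed_domain E.
Proof.
move=> condD I J idI idJ I0 J0; apply: condensed_mulP => c [n [a [b [Ia Jb ->]]]].
(* A section [s] of [phi] lifts the sum term by term into the product of the preimages, where it
   becomes one product [x * y]. *)
have [s sK] := choice phi_surj.
have : ideal_mul (phi @^-1` I) (phi @^-1` J) (\sum_(k < n) s (a k) * s (b k)).
  exists n, (s \o a), (s \o b); split=> // k /=; rewrite sK; [exact: Ia|exact: Jb].
rewrite condD; [|exact: is_ideal_preimage|exact: is_ideal_preimage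
                |exact: preimage_ideal_neq0|exact: preimage_ideal_neq0].
case=> x Ix [y Jy xy]; exists (phi x) => //; exists (phi y) => //.
rewrite -rmorphM xy rmorph_sum; apply: eq_bigr => k _.
by rewrite rmorphM /= !sK.
Qed.

End SurjectiveImage.

Section PolyPair.
Variables (B : idomainType) (A : subringClosed B).

(** [valP f] fits here because membership in A + XB[X] unfolds to membership of the value at 0 in
    A. *)
Definition const_term (f : poly_pair A) : subring_type A :=
  Sub (val f).[0] (valP f).

Fact const_term_zmod_morphism : zmod_morphism const_term.
Proof. by move=> f g; apply: val_inj; rewrite !rmorphB /= hornerD hornerN. Qed.

Fact const_term_monoid_morphism : monoid_morphism const_term.
Proof.
split; first by apply: val_inj; rewrite /= hornerC.
by move=> f g; apply: val_inj; rewrite /= hornerM.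
Qed.

HB.instance Definition _ :=
  GRing.isZmodMorphism.Build (poly_pair A) (subring_type A) const_term
    const_term_zmod_morphism.
HB.instance Definition _ :=
  GRing.isMonoidMorphism.Build (poly_pair A) (subring_type A) const_term
    const_term_monoid_morphism.

Definition poly_pair_of (p : {poly B}) (pA : p \in const_term_in A) :
  poly_pair A := exist (fun p => p \in const_term_in A) p pA.

Lemma const_term_surj (a : subring_type A) : exists f, const_term f = a.
Proof.
have aA : (val a)%:P \in const_term_in A by rewrite unfold_in hornerC (valP a).
by exists (poly_pair_of aA); apply: val_inj; rewrite /= hornerC.
Qed.

Fact mulX_const_term_in (p : {poly B}) : 'X * p \in const_term_in A.
Proof. by rewrite unfold_in hornerM hornerX mul0r rpred0. Qed.

Definition polyX_mul (p : {poly B}) : poly_pair A :=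
  poly_pair_of (mulX_const_term_in p).

(* For [c = 0] and [c = -1] these are the ideals X(b, X)B[X] and
   X(b, X + 1)B[X]. *)
Definition X_eval_ideal (b c : B) : set (poly_pair A) :=
  [set f | exists p d, val f = 'X * p /\ p.[c] = d * b].

(** The polynomials whose value at [c] lies in bB form an ideal of B[X]; X times it stays stable
    under the subring A + XB[X]. *)
Lemma is_ideal_X_eval (b c : B) : is_ideal (X_eval_ideal b c).
Proof.
split=> [|f g [p [d [fp pc]]] [q [e [gq qc]]]|h f [p [d [fp pc]]]].
- by exists 0, 0; rewrite mulr0 horner0 mul0r.
- by exists (p + q), (d + e); rewrite rmorphD /= fp gq mulrDr hornerD pc qc mulrDl.
- exists (val h * p), ((val h).[c] * d).
  by split; [rewrite rmorphM /= fp mulrCA|rewrite hornerM pc mulrA].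
Qed.

Lemma X_eval_ideal_neq0 (b c : B) : b != 0 -> X_eval_ideal b c <> [set 0].
Proof.
move=> b0; apply: (@nonzero_ideal _ _ (polyX_mul b%:P)).
  by exists b%:P, 1; rewrite hornerC mul1r.
by rewrite -val_eqE /= mulf_neq0 ?polyX_eq0 ?polyC_eq0.
Qed.

Lemma polyC_mul_eq (b : B) (p q : {poly B}) : b != 0 -> p * q = b%:P ->
  exists u v, [/\ p = u%:P, q = v%:P & u * v = b].
Proof.
move=> b0 pq; have : p * q != 0 by rewrite pq polyC_eq0.
rewrite mulf_eq0 negb_or => /andP[p0 q0].
have := congr1 (size : {poly B} -> nat) pq.
(* Size is degree plus one, so this reads [(size p + size q).-1 = 1]; as both sizes are positive,
   both are 1. *)
rewrite size_mul // size_polyC b0 => szpq.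
have [sp sq] : (size p <= 1)%N /\ (size q <= 1)%N.
  rewrite -!size_poly_gt0 in p0 q0.
  by move: szpq p0 q0; case: (size p) (size q) => [|[|m]] [|[|n]] //=; rewrite addnS.
exists p`_0, q`_0; split; [exact: size1_polyC|exact: size1_polyC|].
by apply: polyC_inj; rewrite rmorphM /= -!size1_polyC.
Qed.

Lemma condensed_poly_pair_field :
  condensed_domain (poly_pair A) -> GRing.field_axiom B.
Proof.
move=> condR b b0.
(* The element is bX * X(X + 1) + (-X^2) * bX = bX^2, written as a sum of two products. *)
have : ideal_mul (X_eval_ideal b 0) (X_eval_ideal b (-1))
         (polyX_mul b%:P * polyX_mul ('X + 1) + polyX_mul (- 'X) * polyX_mul b%:P).
  exists 2%N, (fun k => if k == ord0 then polyX_mul b%:P else polyX_mul (- 'X)).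
  exists (fun k => if k == ord0 then polyX_mul ('X + 1) else polyX_mul b%:P).
  split=> [k|k|]; last by rewrite big_ord_recl big_ord1.
  - case: ifP => _; first by exists b%:P, 1; rewrite hornerC mul1r.
    by exists (- 'X), 0; rewrite hornerN hornerX oppr0 mul0r.
  - case: ifP => _; last by exists b%:P, 1; rewrite hornerC mul1r.
    by exists ('X + 1), 0; rewrite hornerD hornerX hornerC addNr mul0r.
rewrite condR; [|exact: is_ideal_X_eval|exact: is_ideal_X_eval
                |exact: X_eval_ideal_neq0|exact: X_eval_ideal_neq0].
case=> f [p [d [fp pb]]] [g [q [e [gq qb]]]] /(congr1 val).
rewrite rmorphM rmorphD !rmorphM /= fp gq => fg.
have pq : p * q = b%:P.
  (* Each ideal contributes one factor X, so X^2 cancels from Xp * Xq = bX^2. *)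
  apply: (@mulfI _ ('X * 'X)); first by rewrite mulf_neq0 // polyX_eq0.
  by move: fg; rewrite mulrACA => ->; ring.
have [u [v [pu qv uv]]] := polyC_mul_eq b0 pq.
move: pb qb; rewrite pu qv !hornerC => ud ve.
(* From u = db, v = eb and uv = b comes b = de b^2, so de is the inverse of b. *)
apply/unitrPr; exists (d * e); apply: (mulfI b0).
by rewrite mulr1 -[RHS]uv ud ve; ring.
Qed.

End PolyPair.

Theorem proposition6 (B : idomainType) (A : subringClosed B) :
  condensed_domain (poly_pair A) ->
  GRing.field_axiom B /\ condensed_domain (subring_type A).
Proof.
move=> condR; split; first exact: condensed_poly_pair_field condR.
exact: (condensed_domain_surj (@const_term_surj B A)) condR.
Qed.
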